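(* Let $K$ be a compact line satisfying the following conditions: (i) $K$ has weight at most $\aleph_1$; (ii) each point $x\in K$ of uncountable character is isolated from one side, i.e. one of the intervals $(\leftarrow,x]$ or $[x,\to)$ is open in $K$; (iii) each closed first countable subset of $K$ is metrizable. Suppose moreover that the closure in $K$ of the set of all points of $K$ of uncountable character is scattered. Then $K$ is Valdivia compact.
   Context: A compact line is a compact space together with a linear order which induces its topology. A compact space $K$ is Valdivia (compact) if there are a set $\Gamma$ and a homeomorphism of $K$ onto some $K'\subseteq\mathbb{R}^\Gamma$ such that $\{x\in K' : \{\gamma\in\Gamma : x(\gamma)\neq 0\}\text{ is countable}\}$ is dense in $K'$. A point $x\in K$ has uncountable character if it has no countable neighborhood base in $K$. A topological space is scattered if each of its nonempty subspaces has a (relatively) isolated point. *)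

(* Defs.v *)
From HB Require Import structures.
From mathcomp Require Import all_boot all_order all_algebra.
From mathcomp Require Import all_classical all_reals topology.

Set Implicit Arguments.
Unset Strict Implicit.
Unset Printing Implicit Defensive.

Import Order.TTheory GRing.Theory Num.Theory.
Import numFieldTopology.Exports.

Local Open Scope card_scope.
Local Open Scope classical_set_scope.
Local Open Scope ring_scope.

(* The cardinal aleph_1 is the least uncountable cardinal. *)
Definition is_aleph1 (U : Type) (W : set U) : Prop :=
  ~ countable W /\
  forall (V : Type) (B : set V), ~ countable B -> W #<= B.

Definition card_le_aleph1 (T : Type) (A : set T) : Prop :=
  exists (U : Type) (W : set U), is_aleph1 W /\ A #<= W.

Definition weight_le_aleph1 (T : topologicalType) : Prop :=
  exists2 B : set (set T), basis B & card_le_aleph1 B.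

(* [filter_from B id --> x] says that each neighborhood of x contains
   a member of B. *)
Definition nbhs_base (T : topologicalType) (x : T) (B : set (set T)) : Prop :=
  B `<=` nbhs x /\ filter_from B id --> x.

Definition countable_character (T : topologicalType) (x : T) : Prop :=
  exists2 B : set (set T), countable B & nbhs_base x B.

Definition uncountable_character (T : topologicalType) : set T :=
  [set x | ~ countable_character x].

Arguments uncountable_character : clear implicits.

Definition first_countable (T : topologicalType) : Prop :=
  forall x : T, countable_character x.

Definition scattered (T : topologicalType) : Prop :=
  forall A : set T, A !=set0 -> isolated A !=set0.

Definition homeomorphism (S T : topologicalType) (f : S -> T) : Prop :=
  continuous f /\ exists g : T -> S, [/\ continuous g, cancel f g & cancel g f].

Definition metrizable (R : realType) (T : topologicalType) : Prop :=
  exists (M : metricType R) (f : T -> M), homeomorphism f.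

(* [set_type K'] carries the topology induced by the product topology of
   R^Gamma. *)
Definition valdivia_compact (R : realType) (T : topologicalType) : Prop :=
  compact [set: T] /\
  exists (Gamma : Type) (K' : set {ptws Gamma -> R}),
    (exists f : T -> set_type K', homeomorphism f) /\
    dense [set x : set_type K' |
            countable [set gamma | (set_val x : Gamma -> R) gamma != 0]].

(* Main.v *)
(* Write "x ~ y" if some family of continuous functions separates the points of
   the interval between x and y and, at each point of countable character, all
   but countably many members of the family vanish.  By (ii) every point c
   admits countably many continuous functions that vanish to the left of c and
   have no common zero to its right, so ~ is transitive.  The classes of ~ are
   closed intervals: at a supremum of countable cofinality countably many
   families are put together, and at a supremum x of uncountable cofinality
   x is isolated from the right and [p, x) is cut into pieces indexed by a well
   order whose proper initial segments are countable, which exists because the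
   weight is at most aleph_1; functions attached to a piece are made to vanish
   to its left.  An interval that misses the closure F of the set of points of
   uncountable character is metrizable by (iii), hence in one class.  If there
   were two classes, the left ends of the classes other than the first one
   would form a nonempty subset of F without isolated points, contradicting
   scatteredness.  So one family works for all of K.  The points of countable
   character are dense, because a relatively isolated point of an open set
   contained in F is isolated in K. *)
Require Import Defs.
From HB Require Import structures.
From mathcomp Require Import all_boot all_order all_algebra.
From mathcomp Require Import all_classical all_reals topology normedtype.
From mathcomp Require Import wochoice.
Set Implicit Arguments.
Unset Strict Implicit.
Unset Printing Implicit Defensive.
Import Order.TTheory GRing.Theory Num.Theory.
Import numFieldTopology.Exports.
Local Open Scope classical_set_scope.
Local Open Scope ring_scope.

(** * Countable sets and well-orders with countable initial segments *)

Lemma countableU (T : Type) (A B : set T) :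
  countable A -> countable B -> countable (A `|` B).
Proof.
move=> cA cB; rewrite -bigcup2E; apply: bigcup_countable => [|[|[|i]] _] //=.
Qed.

(** Well-order the type and take the least element of [C] whose segment in [C] is uncountable: that
    segment is at least as large as [C], and by minimality its proper segments are countable. If
    there is no such element, [C] itself serves. *)
Lemma aleph1_well_order (T : eqType) (C : set T) : card_le_aleph1 C ->
  exists (J : set T) (prec : rel T),
    [/\ (C #<= J)%card, forall a b, [|| prec a b, prec b a | a == b],
        forall A : set T, A !=set0 ->
          exists2 m, A m & forall b, prec b m -> ~ A b
      & forall a, J a -> countable [set b | J b /\ prec b a]].
Proof.
move=> [U [W [[_ Wmin] CW]]].
have [le wo] := well_ordering_principle T.
have min (A : set T) : A !=set0 ->
    exists2 m, A m & forall b, ~~ le m b -> ~ A b.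
  move=> [a Aa]; have [|m [[Am mA] _]] := wo (mem A).
    by exists a; exact: mem_set.
  exists m; first exact: set_mem.
  by move=> b + Ab; rewrite mA//; exact: mem_set.
(* Reflexivity and antisymmetry come from the unique minima of singletons and pairs. *)
have le_refl a : le a a.
  have [|m [[/eqP -> mA] _]] := wo (pred1 a); first by exists a; apply: eqxx.
  by apply: mA; apply: eqxx.
have anti a b : [|| ~~ le b a, ~~ le a b | a == b].
  have [ba|//] := boolP (le b a); have [ab|//] := boolP (le a b).
  have [|m [_ mU]] := wo (pred2 a b).
    by exists a; rewrite inE eqxx.
  suff [/mU ma /mU mb] :
      minimum_of le (pred2 a b) a /\ minimum_of le (pred2 a b) b.
    by rewrite -ma mb eqxx !orbT.
  split; split; rewrite ?inE ?eqxx ?orbT// => c.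
    by rewrite !inE => /orP[] /eqP ->.
  by rewrite !inE => /orP[] /eqP ->.
pose prec a b := ~~ le b a.
pose unc a := C a /\ ~ countable [set b | C b /\ prec b a].
have [[a0 unca0]|allc] := pselect (exists a, unc a); last first.
  exists C, prec; split=> //.
  by move=> a Ca; apply: contra_notP allc => unca; exists a.
have [|a [Ca unca] amin] := min [set a | unc a].
  by exists a0.
exists [set b | C b /\ prec b a], prec; split=> //.
  exact: card_le_trans CW (Wmin _ _ unca).
move=> b [Cb ba]; have cb : countable [set c | C c /\ prec c b].
  by have := amin b ba; apply: contra_notP.
by apply: sub_countable cb; apply: subset_card_le => c [[]].
Qed.

(** * Families of continuous functions with countable supports *)

Section sigma_separated.
Context {R : realType} {T : topologicalType}.
Implicit Types (S : set T) (F : set (T -> R)).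

(** Equivalently, evaluation at the members of [F] sends the points of countable character into a
    Sigma-product of real lines. *)
Definition sigma_family F :=
  (forall f, F f -> continuous f) /\
  forall z, countable_character z -> countable [set f | F f /\ f z != 0].

Definition sigma_separated S := exists2 F, sigma_family F &
  forall x y, S x -> S y -> x != y -> exists2 f, F f & f x != f y.

Lemma sigma_separatedS S1 S2 :
  S1 `<=` S2 -> sigma_separated S2 -> sigma_separated S1.
Proof.
move=> S12 [F sF sepF]; exists F => // x y /S12 S2x /S12 S2y; exact: sepF.
Qed.

Lemma countable_sigma_family F :
  (forall f, F f -> continuous f) -> countable F -> sigma_family F.
Proof.
move=> cF ctF; split=> // z _.
by apply: sub_countable ctF; apply: subset_card_le => f [].
Qed.

Lemma bigcup_sigma_family I (D : set I) (F : I -> set (T -> R)) :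
  (forall i, D i -> sigma_family (F i)) ->
  (forall z, countable_character z ->
    countable [set i | D i /\ exists2 f, F i f & f z != 0]) ->
  sigma_family (\bigcup_(i in D) F i).
Proof.
move=> sF cD; split=> [f [i Di]|z cz]; first by case: (sF i Di) => + _; apply.
have := bigcup_countable (cD z cz)
  (fun i Di => (sF i (proj1 Di)).2 z cz).
apply: sub_countable; apply: subset_card_le => f [[i Di Fif] fz].
by exists i => //; split=> //; exists f.
Qed.

Lemma setU_sigma_family F1 F2 :
  sigma_family F1 -> sigma_family F2 -> sigma_family (F1 `|` F2).
Proof.
move=> sF1 sF2; rewrite -bigcup2E; apply: bigcup_sigma_family => [|z _].
  by case=> [|[|i]] _ //=; exact: countable_sigma_family.
exact: countableP.
Qed.

Lemma continuous_indicator (U : set T) : open U -> closed U ->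
  continuous (fun x => if x \in U then 1 else 0 : R).
Proof.
move=> oU cU x; apply: cvg_near_cst; have [Ux|nUx] := boolP (x \in U).
  apply: filterS (open_nbhs_nbhs (conj oU (set_mem Ux))) => y /= Uy.
  by rewrite mem_set.
have : nbhs x (~` U).
  apply: open_nbhs_nbhs; split; first exact: closed_openC.
  by move=> /mem_set; rewrite (negPf nUx).
apply: filterS => y /= Uy; case: ifPn => // /set_mem //.
Qed.

Lemma urysohn_function (A B : set T) :
  hausdorff_space T -> compact [set: T] -> closed A -> closed B ->
  A `&` B = set0 -> exists f : T -> R,
    [/\ continuous f, forall x, A x -> f x = 0 & forall x, B x -> f x = 1].
Proof.
move=> hT cT cA cB AB0.
have /(@uniform_separatorP _ R)[f [cf _ fA fB]] :=
  normal_uniform_separator (compact_normal hT cT) cA cB AB0.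
by exists f; split=> // x Ax; [apply: fA|apply: fB]; exists x.
Qed.

Lemma continuous_mul (f g : T -> R) :
  continuous f -> continuous g -> continuous (fun x => f x * g x).
Proof.
move=> cf cg x; exact: (cvg_comp2 (cf x) (cg x) (@mul_continuous R (f x, g x))).
Qed.

End sigma_separated.

(** * The line with reversed order *)

Section dual_line.
Context {d : Order.disp_t} (K : orderTopologicalType d).

(** Only the order is reversed; the topology is that of [K], so compactness, weight and character
    carry over by conversion. *)
Definition dual_line : Type := K^d.

HB.instance Definition _ := Order.Total.on dual_line.
HB.instance Definition _ := Topological.copy dual_line K.

Lemma dual_itv_nbhsE (x : dual_line) : nbhs x = filter_from
  (fun i : interval dual_line => itv_open_ends i /\ x \in i)
  (fun i => [set` i]).
Proof.
have -> : nbhs x = nbhs (x : K) by [].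
rewrite itv_nbhsE.
apply/seteqP; split=> U /=.
- case=> -[[[] a|[]] [[] b|[]]] //= [// _ xi] iU.
  + exists (Interval (BRight (b : dual_line)) (BLeft (a : dual_line))).
      by split=> //; move: xi; rewrite !in_itv /= andbC.
    by move=> z zi; apply: iU; move: zi; rewrite /= !in_itv /= andbC.
  + exists (Interval (BInfty _ true) (BLeft (a : dual_line))).
      by split=> //; move: xi; rewrite !in_itv /= andbT.
    by move=> z zi; apply: iU; move: zi; rewrite /= !in_itv /= andbT.
  + exists (Interval (BRight (b : dual_line)) (BInfty _ false)).
      by split=> //; move: xi; rewrite !in_itv /= andbT.
    by move=> z zi; apply: iU; move: zi; rewrite /= !in_itv /= andbT.
  + by exists `]-oo, +oo[%O => // z _; exact: iU.
- case=> -[[[] a|[]] [[] b|[]]] //= [// _ xi] iU.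
  + exists (Interval (BRight (b : K)) (BLeft (a : K))).
      by split=> //; move: xi; rewrite !in_itv /= andbC.
    by move=> z zi; apply: iU; move: zi; rewrite /= !in_itv /= andbC.
  + exists (Interval (BInfty _ true) (BLeft (a : K))).
      by split=> //; move: xi; rewrite !in_itv /= andbT.
    by move=> z zi; apply: iU; move: zi; rewrite /= !in_itv /= andbT.
  + exists (Interval (BRight (b : K)) (BInfty _ false)).
      by split=> //; move: xi; rewrite !in_itv /= andbT.
    by move=> z zi; apply: iU; move: zi; rewrite /= !in_itv /= andbT.
  + by exists `]-oo, +oo[%O => // z _; exact: iU.
Qed.

HB.instance Definition _ := Order_isNbhs.Build _ dual_line dual_itv_nbhsE.

End dual_line.

(** * Rays, one-sided neighborhoods and suprema *)

Section line.
Context {d : Order.disp_t} {K : orderTopologicalType d}.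
Implicit Types (x y z p c : K) (S U : set K).
Local Open Scope order_scope.

Lemma open_ray_lt x : open [set z | z < x].
Proof. by rewrite -set_itvNyo; exact: lray_open. Qed.

Lemma open_ray_gt x : open [set z | x < z].
Proof. by rewrite -set_itvoy; exact: rray_open. Qed.

Lemma closed_ray_le x : closed [set z | z <= x].
Proof. by rewrite -set_itvNyc; exact: lray_closed. Qed.

Lemma closed_ray_ge x : closed [set z | x <= z].
Proof. by rewrite -set_itvcy; exact: rray_closed. Qed.

Lemma nbhs_left x p U : nbhs x U -> p < x ->
  exists2 u, p <= u < x & forall z, u < z <= x -> U z.
Proof.
rewrite itv_nbhsE => -[[a b] [oab xab] abU] px.
move: (xab); rewrite itv_boundlr => /andP[ax xb].
have bz z : z <= x -> (BRight z <= b)%O.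
  by move=> zx; apply: le_trans xb; rewrite bnd_simp.
have [E|[t E]] : a = -oo \/ exists t, a = BRight t.
  case: a oab {xab abU} ax => [e a|[]] oab ax; last by [].
    by right; exists a; rewrite (itv_open_ends_lside oab).
  by left.
  exists p; first by rewrite lexx.
  by move=> z /andP[_ /bz zb]; apply: abU; rewrite /= itv_boundlr zb E.
move: ax; rewrite E bnd_simp => tx.
exists (Order.max p t); first by rewrite le_max lexx gt_max px.
move=> z /andP[]; rewrite gt_max => /andP[_ tz] /bz zb.
by apply: abU; rewrite /= itv_boundlr zb E bnd_simp tz.
Qed.

(** The final segments of [S] form a filter base, and a cluster point of it is a supremum. *)
Lemma exists_sup S : compact [set: K] -> S !=set0 ->
  exists s, (forall x, S x -> x <= s) /\
    (forall u, (forall x, S x -> x <= u) -> s <= u).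
Proof.
move=> cK [x0 Sx0].
pose F := filter_from S (fun x => [set z | S z /\ x <= z]).
have FF : ProperFilter F.
  apply: filter_from_proper => [|x Sx]; last by exists x.
  apply: filter_from_filter; first by exists x0.
  move=> x y Sx Sy; exists (Order.max x y).
    by case: (leP x y).
  by move=> z [Sz]; rewrite ge_max => /andP[xz yz].
have [s [_ Fs]] := cK F FF filterT.
have FS x : S x -> F [set z | S z /\ x <= z] by move=> Sx; exists x.
exists s; split=> [x Sx|u uS].
  rewrite leNgt; apply/negP => sx.
  have [z [[_ /= xz]]] :=
    Fs _ _ (FS x Sx) (open_nbhs_nbhs (conj (open_ray_lt x) sx)).
  by rewrite /= ltNge xz.
rewrite leNgt; apply/negP => us.
have [z [[/uS zu _]]] :=
  Fs _ _ (FS x0 Sx0) (open_nbhs_nbhs (conj (open_ray_gt u) us)).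
by rewrite /= ltNge zu.
Qed.

End line.

(** * Second countable subspaces *)

Section second_countability.
Context {T : topologicalType}.

Lemma nbhs_set_type (S : set T) (x : set_type S) (U : set (set_type S)) :
  nbhs x U -> exists2 V, nbhs (set_val x) V & set_val @^-1` V `<=` U.
Proof.
move=> [V [[W oW <-]] Wx WU]; exists W => //.
exact: open_nbhs_nbhs.
Qed.

Lemma countable_character_set_type (S : set T) (x : set_type S) :
  countable_character (set_val x) -> countable_character x.
Proof.
move=> [B cB [Bx Bto]]; exists [set set_val @^-1` b | b in B].
  exact: sub_countable (card_image_le _ _) cB.
split=> [_ [b /Bx bx <-]|U /nbhs_set_type[V /Bto[b Bb bV] VU]].
  exact: initial_continuous.
by exists (set_val @^-1` b); [exists b|move=> y /bV /VU].
Qed.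

Lemma compact_set_type (S : set T) : compact S -> compact [set: set_type S].
Proof.
move=> cS F FF _; have FS : (set_val @ F) S.
  by apply: (@filterE _ F) => x; exact: set_valP.
have [p [Sp Fp]] := cS _ _ FS.
exists (SigSub (mem_set Sp)); split=> // A B FA /nbhs_set_type[V Vp VB].
have FvA : (set_val @ F) (set_val @` A).
  exact: (@filterS _ F _ _ _ (@preimage_image _ _ set_val A) FA).
have [_ [[z Az <-] Vz]] := Fp _ _ FvA Vp.
by exists z; split=> //; exact: VB.
Qed.

Lemma second_countable_homeo (U : topologicalType) (f : T -> U) :
  homeomorphism f -> @second_countable U -> @second_countable T.
Proof.
move=> [cf [g [cg fK gK]]] [B cB [Bo Bto]]; exists [set f @^-1` b | b in B].
  exact: sub_countable (card_image_le _ _) cB.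
split=> [_ [b /Bo bo <-]|x V Vx].
  by apply: open_comp => // y _; exact: cf.
have : nbhs (f x) (g @^-1` V) by apply: cg; rewrite fK.
move=> /Bto[b [Bb bfx] bV]; exists (f @^-1` b).
  by split; [exists b|].
by move=> y /bV /=; rewrite fK.
Qed.

Lemma compact_homeo (U : topologicalType) (f : T -> U) :
  homeomorphism f -> compact [set: T] -> compact [set: U].
Proof.
move=> [cf [g [cg fK gK]]] cT.
have -> : [set: U] = f @` setT by apply/seteqP; split=> // y _; exists (g y).
by apply: continuous_compact => //; exact: continuous_subspaceT.
Qed.

Lemma compact_metrizable_second_countable (R : realType) :
  metrizable R T -> compact [set: T] -> @second_countable T.
Proof.
move=> [M [f hf]] /(compact_homeo hf) cM; apply: (second_countable_homeo hf).
have [[m0]|nM] := pselect (inhabited M); last first.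
  exists set0; first exact: countable0.
  by split=> // x; case: nM; constructor.
pose pM := isPointed.Build M m0.
pose PM : pseudoPMetricType R := HB.pack M pM.
exact: (@compact_second_countable R PM).
Qed.

(** For each pair of basic sets of [S] kept apart by some continuous function on [T], one such
    function is chosen. A Urysohn function for two points, cut at 1/2, shows that they lie in such a
    pair. *)
Lemma second_countable_sigma_separated (R : realType) (S : set T) :
  hausdorff_space T -> compact [set: T] ->
  @second_countable (set_type S) -> @sigma_separated R T S.
Proof.
move=> hT cT [B cB [Bo Bto]].
pose apart (f : T -> R) (P : set (set_type S) * set (set_type S)) :=
  continuous f /\ forall s t, P.1 s -> P.2 t -> f (set_val s) != f (set_val t).
have /choice[f fP] P : exists f, (exists g, apart g P) -> apart f P.
  have [[g gP]|nP] := pselect (exists g, apart g P); first by exists g.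
  by exists (fun=> 0) => /nP.
exists (f @` ((B `*` B) `&` [set P | apart (f P) P])).
  apply: countable_sigma_family => [_ [P [_ [+ _]] <-] //|].
  apply: sub_countable (card_image_le _ _) _.
  apply: sub_countable (countableX cB cB).
  by apply: subset_card_le => P [].
move=> x y Sx Sy xy.
have cl1 (z : T) : closed [set z].
  exact: accessible_closed_set1 (hausdorff_accessible hT) z.
have [|h [ch hx hy]] :=
    @urysohn_function R T [set x] [set y] hT cT (cl1 x) (cl1 y).
  by apply/seteqP; split=> // z [/= -> /eqP]; rewrite (negPf xy).
pose sx : set_type S := SigSub (mem_set Sx).
pose sy : set_type S := SigSub (mem_set Sy).
pose hv (s : set_type S) := h (set_val s).
have chv : continuous hv.
  by move=> s; apply: continuous_comp; [exact: initial_continuous|exact: ch].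
have /Bto[P [BP Px] Ph] : nbhs sx (hv @^-1` [set r | r < 2^-1]).
  apply: chv; apply: open_nbhs_nbhs; split; first exact: open_lt.
  by rewrite /= /hv hx// invr_gt0.
have /Bto[Q [BQ Qy] Qh] : nbhs sy (hv @^-1` [set r | 2^-1 < r]).
  apply: chv; apply: open_nbhs_nbhs; split; first exact: open_gt.
  by rewrite /= /hv hy// invf_lt1// ltr1n.
have fPQ : apart (f (P, Q)) (P, Q).
  apply: fP; exists h; split=> // s t /Ph /= hs /Qh /= ht.
  by rewrite lt_eqF// (lt_trans hs ht).
exists (f (P, Q)); first by exists (P, Q).
by case: fPQ => _ /(_ sx sy Px Qy).
Qed.

End second_countability.

(** * Cuts and gluing of intervals *)

Section compact_line.
Context {R : realType} {d : Order.disp_t} {K : orderTopologicalType d}.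
Implicit Types (x y z p c : K) (F : set (K -> R)).
Local Open Scope order_scope.

Definition one_sided := forall x, uncountable_character K x ->
  open [set z | z <= x] \/ open [set z | x <= z].

Hypothesis K_compact : compact [set: K].
Hypothesis K_one_sided : one_sided.

Local Notation good := (@sigma_separated R K).

Lemma ltW_sigma_separated (S : set K) F : sigma_family F ->
  (forall x y, S x -> S y -> x < y -> exists2 f, F f & f x != f y) -> good S.
Proof.
move=> sF sepF; exists F => // x y Sx Sy /lt_total/orP[xy|yx].
  exact: sepF.
by have [f Ff fyx] := sepF _ _ Sy Sx yx; exists f => //; rewrite eq_sym.
Qed.

(** Values at [c] are left free, in order to admit the indicator of [c, ->) when that ray is
    open. *)
Definition cut_family c F := [/\ countable F, forall f, F f -> continuous f,
  forall f z, F f -> z < c -> f z = 0 &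
  forall z, c < z -> exists2 f, F f & f z != 0].

(** If [c] has uncountable character or (<-, c] is open, one indicator suffices. Otherwise each
    member of a countable base at [c] contains some e > c; Urysohn functions that are 0 up to [c]
    and 1 from e on form the family, because these e come arbitrarily close to [c]. *)
Lemma exists_cut_family c : exists F, cut_family c F.
Proof.
have open_cut (U : set K) : open U -> closed U -> (forall z, z < c -> ~ U z) ->
    (forall z, c < z -> U z) -> exists F, cut_family c F.
  move=> oU cU Ult Ugt; exists [set fun x => if x \in U then 1 else 0].
  split=> [|_ ->|_ z -> /Ult Uz|z /Ugt Uz].
  - exact: countable1.
  - exact: continuous_indicator.
  - by rewrite memNset.
  - by eexists; [reflexivity|rewrite /= mem_set// oner_neq0].
have cut_right : open [set z | z <= c] -> exists F, cut_family c F.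
  move=> oc; apply: (open_cut [set z | c < z]) => //; first exact: open_ray_gt.
    rewrite (_ : [set z | c < z] = ~` [set z | z <= c]).
      exact: open_closedC.
    by apply/seteqP; split=> z /=; rewrite ltNge => /negP.
  by move=> z zc /=; rewrite ltNge (ltW zc).
have [ucc|/contrapT [B cB [Bc Bto]]] := pselect (uncountable_character K c).
  have [/cut_right//|oc] := K_one_sided ucc.
  apply: (open_cut [set z | c <= z]) => //; first exact: closed_ray_ge.
    by move=> z zc /=; rewrite leNgt zc.
  by move=> z /ltW.
have [[b Bb bc]|nb] := pselect (exists2 b, B b & forall z, b z -> z <= c).
  apply: cut_right; rewrite openE => z /= zc.
  have : nbhs c [set z | z <= c] by apply: filterS (Bc b Bb).
  move: zc; rewrite le_eqVlt => /orP[/eqP -> //|zc _].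
  by apply: filterS (open_nbhs_nbhs (conj (open_ray_lt c) zc)) => y /ltW.
have /choice[f fP] b : exists f : K -> R, B b -> [/\ continuous f,
    forall z, z <= c -> f z = 0 & exists2 e, b e & forall z, e <= z -> f z = 1].
  have [Bb|nBb] := pselect (B b); last by exists (fun=> 0) => /nBb.
  have [e be ce] : exists2 e, b e & c < e.
    apply: contra_notP nb => nb; exists b => // z bz.
    by rewrite leNgt; apply/negP => cz; apply: nb; exists z.
  have [|f [cf f0 f1]] := @urysohn_function R K _ _ order_hausdorff K_compact
    (@closed_ray_le _ K c) (@closed_ray_ge _ K e).
    apply/seteqP; split=> // z [/= zc ez].
    by move: (lt_le_trans ce (le_trans ez zc)); rewrite ltxx.
  by exists f => _; split=> //; exists e.
exists (f @` B); split.
- exact: sub_countable (card_image_le _ _) cB.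
- by move=> _ [b /fP[+ _ _] <-].
- by move=> _ z [b /fP[_ f0 _] <-] /ltW /f0.
move=> z cz.
have /Bto[b Bb bz] := open_nbhs_nbhs (conj (open_ray_lt z) cz).
exists (f b); first by exists b.
have [_ _ [e /bz ez ->]] := fP b Bb; first exact: oner_neq0.
exact: ltW.
Qed.

(** Points strictly on opposite sides of [c] are separated by a cut family at [c]. *)
Lemma sigma_separated_glue a c b :
  good [set z | a <= z <= c] -> good [set z | c <= z <= b] ->
  good [set z | a <= z <= b].
Proof.
move=> [F1 sF1 sep1] [F2 sF2 sep2].
have [F3 [cF3 ctF3 F3lt F3gt]] := exists_cut_family c.
apply: (@ltW_sigma_separated _ (F1 `|` (F2 `|` F3))).
  apply: setU_sigma_family => //; apply: setU_sigma_family => //.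
  exact: countable_sigma_family.
move=> x y /= /andP[ax xb] /andP[ay yb] xy.
have [yc|cy] := leP y c.
  have [||f Ff fxy] := sep1 x y _ _ (negbT (lt_eqF xy)).
  - by rewrite /= ax (le_trans (ltW xy)).
  - by rewrite /= ay.
  by exists f => //; left.
have [cx|xc] := leP c x.
  have [||f Ff fxy] := sep2 x y _ _ (negbT (lt_eqF xy)).
  - by rewrite /= cx.
  - by rewrite /= yb (ltW cy).
  by exists f => //; right; left.
have [f Ff fy] := F3gt _ cy; exists f; first by right; right.
by rewrite (F3lt _ _ Ff xc) eq_sym.
Qed.

Lemma sigma_separated_jump a b : a < b -> (forall z, ~ a < z < b) ->
  good [set z | a <= z <= b].
Proof.
move=> ab nab.
have leE : [set z | z <= a] = [set z | z < b].
  apply/seteqP; split=> z /=; first by move/le_lt_trans; apply.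
  by move=> zb; rewrite leNgt; apply/negP => az; apply: (nab z); rewrite az.
apply: (@ltW_sigma_separated _
  [set fun x => if x \in [set z | z <= a] then 1 else 0]).
  apply: countable_sigma_family; last exact: countable1.
  move=> _ ->; apply: continuous_indicator; last exact: closed_ray_le.
  by rewrite leE; exact: open_ray_lt.
move=> x y /= /andP[ax xb] /andP[ay yb] xy; eexists; first by [].
have xa : x <= a.
  by have : [set z | z < b] x by [exact: lt_le_trans xy yb]; rewrite -leE.
rewrite /= mem_set// memNset ?oner_neq0//= => ya.
by move: (lt_le_trans xy (le_trans ya ax)); rewrite ltxx.
Qed.

End compact_line.

(** * Intervals up to a limit point *)

Section limit.
Context {R : realType} {d : Order.disp_t} {K : orderTopologicalType d}.
Implicit Types (x y z p c : K) (F : set (K -> R)).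
Local Open Scope order_scope.

Hypothesis K_compact : compact [set: K].
Hypothesis K_one_sided : one_sided (K := K).
Hypothesis K_weight : weight_le_aleph1 K.

Local Notation good := (@sigma_separated R K).

Definition cofinal_in p x (C : set K) :=
  (forall c, C c -> p <= c < x) /\ forall y, y < x -> exists2 c, C c & y < c.

(** For u < v, take c in [C] above u: if v <= c, the family for [p, c] separates them, otherwise the
    cut family at c does. *)
Lemma sigma_separated_countable_limit p x C : countable C -> cofinal_in p x C ->
  (forall y, p <= y < x -> good [set z | p <= z <= y]) ->
  good [set z | p <= z <= x].
Proof.
move=> cC [Cpx Ccof] gpx.
have /choice[Kc KcP] := exists_cut_family (R := R) K_compact K_one_sided.
have /choice[G GP] c : exists F, C c -> sigma_family F /\
    forall x y, p <= x <= c -> p <= y <= c -> x != y ->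
      exists2 f, F f & f x != f y.
  have [Cc|nCc] := pselect (C c); last by exists set0.
  by have [F sF sepF] := gpx c (Cpx c Cc); exists F.
apply: (@ltW_sigma_separated _ _ _ _ (\bigcup_(c in C) (G c `|` Kc c))).
  apply: bigcup_sigma_family => [c Cc|z _].
    apply: setU_sigma_family; first by case: (GP c Cc).
    by have [cKc ctKc _ _] := KcP c; exact: countable_sigma_family.
  by apply: sub_countable cC; apply: subset_card_le => c [].
move=> u v /= /andP[pu ux] /andP[pv vx] uv.
have [c Cc uc] := Ccof u (lt_le_trans uv vx).
have [vc|cv] := leP v c.
  have [||f Gf fuv] := (GP c Cc).2 u v _ _ (negbT (lt_eqF uv)).
  - by rewrite pu ltW.
  - by rewrite pv.
  by exists f => //; exists c => //; left.
have [_ _ Kc0 /(_ v cv)[f Kf fv]] := KcP c.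
exists f; first by exists c => //; right.
by rewrite (Kc0 _ _ Kf uc) eq_sym.
Qed.

(** Choosing a point of [p, x) in each member of a countable base at [x] would give a countable
    cofinal set. *)
Lemma cofinal_uncountable_character p x :
  (forall y, y < x -> exists z, y < z < x) -> p < x ->
  ~ (exists2 C, countable C & cofinal_in p x C) -> uncountable_character K x.
Proof.
move=> dx px; apply: contra_not => -[B cB [Bx Bto]].
have /choice[e eP] b : exists e, B b -> b e /\ p <= e < x.
  have [Bb|nBb] := pselect (B b); last by exists p => /nBb.
  have [u /andP[pu ux] ub] := nbhs_left (Bx b Bb) px.
  have [e /andP[ue ex]] := dx u ux; exists e => _; split.
    by apply: ub; rewrite ue ltW.
  by rewrite ex (le_trans pu (ltW ue)).
exists (e @` B); first exact: sub_countable (card_image_le _ _) cB.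
split=> [_ [b /eP[_ +] <-] //|y yx].
have /Bto[b Bb by_] := open_nbhs_nbhs (conj (open_ray_gt y) yx).
by exists (e b); [exists b|apply: by_; case: (eP b Bb)].
Qed.

(** A point of [p, x) is chosen in each member of a small base of [K] that meets [p, x). *)
Lemma cofinal_aleph1 p x : (forall y, y < x -> exists z, y < z < x) -> p < x ->
  exists2 C, card_le_aleph1 C & cofinal_in p x C.
Proof.
move=> dx px; have [B [Bo Bto] [U [W [Waleph BW]]]] := K_weight.
pose meets (b : set K) := exists2 z, b z & p <= z < x.
have /choice[e eP] b : exists e, meets b -> b e /\ p <= e < x.
  have [[z bz zx]|nb] := pselect (meets b); first by exists z.
  by exists p => /nb.
exists (e @` (B `&` meets)).
  exists U, W; split=> //; apply: card_le_trans (card_image_le _ _) _.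
  by apply: card_le_trans BW; apply: subset_card_le => b [].
split=> [_ [b [_ /eP[_ +]] <-] //|y yx].
have [|z /andP[pyz zx]] := dx (Order.max p y); first by rewrite gt_max px.
move: pyz; rewrite gt_max => /andP[pz yz].
have /Bto[b [Bb bz] by_] := open_nbhs_nbhs (conj (open_ray_gt y) yz).
have mb : meets b by exists z => //; rewrite (ltW pz).
by exists (e b); [exists b|apply: by_; case: (eP b mb)].
Qed.

Lemma mul_sigma_family F H : sigma_family F -> countable H ->
  (forall h, H h -> continuous h) ->
  sigma_family (\bigcup_(h in H) [set (fun z => f z * h z)%R | f in F]).
Proof.
move=> [cF F0] cH ctH; apply: bigcup_sigma_family => [h Hh|z _]; last first.
  by apply: sub_countable cH; apply: subset_card_le => h [].
split=> [_ [f Ff <-]|z cz].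
  by apply: continuous_mul; [exact: cF|exact: ctH].
apply: sub_countable (F0 z cz).
apply: card_le_trans (card_image_le (fun f z => f z * h z)%R _).
apply: subset_card_le => _ [[f Ff <-] fz]; exists f => //; split=> //.
by apply: contra_neq fz => ->; rewrite mul0r.
Qed.

(** The pieces [y a, t a], for [a] in [J], cover [p, x), and the functions attached to [a] vanish
    outside [y a, x]. A point z < x lies below some [g a'], so only [a'] and its countably many
    predecessors matter at z. The point [x] has uncountable character and imposes no countability
    condition. *)
Lemma sigma_separated_uncountable_limit p x :
  (forall y, y < x -> exists z, y < z < x) -> p < x ->
  ~ (exists2 C, countable C & cofinal_in p x C) ->
  (forall y, p <= y < x -> good [set z | p <= z <= y]) ->
  good [set z | p <= z <= x].
Proof.
move=> dx px nC gpx.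
have ucx := cofinal_uncountable_character dx px nC.
(* As [x] is a limit from the left, [x, ->) is not open, so (ii) leaves only (<-, x]. *)
have ox : open [set z | z <= x].
  have [//|] := K_one_sided ucx; rewrite openE => /(_ x (lexx x)).
  move=> /nbhs_left/(_ px)[u /andP[_ ux] ug].
  have [z /andP[uz zx]] := dx u ux.
  by have := ug z; rewrite uz ltW //= leNgt zx => /(_ isT).
have [C /aleph1_well_order[J [prec [CJ tri minP Jseg]]] [Cpx Ccof]] :=
  cofinal_aleph1 dx px.
have [g gJ Jg] : exists2 g : K -> K, forall a, J a -> C (g a) &
    forall y, y < x -> exists2 a, J a & y < g a.
  have [C0|[g]] := pfcard_geP CJ.
    by have [c] := Ccof p px; rewrite C0.
  exists g => [a Ja|y /Ccof[c Cc yc]]; first exact: (@funS _ _ _ _ g).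
  by have [a Ja gac] := @surj _ _ _ _ g _ Cc; exists a => //; rewrite gac.
pose below a u := forall b, J b -> prec b a -> g b <= u.
(* [y a] is the supremum of [p] and the earlier values of [g]. It stays below [x] because countably
   many values are not cofinal. *)
have /choice[y yP] a : exists s, J a -> [/\ p <= s < x, below a s &
    forall u, p <= u -> below a u -> s <= u].
  have [Ja|nJa] := pselect (J a); last by exists p => /nJa.
  have [|s [sub sleast]] :=
    @exists_sup _ K (p |` [set g b | b in [set b | J b /\ prec b a]]) K_compact.
    by exists p; left.
  exists s => _; split.
  - rewrite sub/=; last by left.
    have [v vx vS] : exists2 v, v < x &
        forall b, J b -> prec b a -> g b <= v.
      apply: contra_notP nC => nv.
      exists [set g b | b in [set b | J b /\ prec b a]].
        exact: sub_countable (card_image_le _ _) (Jseg a Ja).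
      split=> [_ [b [Jb _] <-]|v vx]; first exact/Cpx/gJ.
      apply: contra_notP nv => nv; exists v => // b Jb ba.
      rewrite leNgt; apply/negP => vgb; apply: nv.
      by exists (g b) => //; exists b.
    apply: (@le_lt_trans _ _ (Order.max p v)); last by rewrite gt_max px.
    apply: sleast => _ [->|[b [Jb ba] <-]]; first by rewrite le_max lexx.
    by rewrite le_max vS ?orbT.
  - by move=> b Jb ba; apply: sub; right; exists b.
  - by move=> u pu bu; apply: sleast => _ [->//|[b [Jb ba] <-]]; exact: bu.
(* The maximum is taken because [g a] may lie below earlier values of [g]. *)
pose t a := Order.max (y a) (g a).
have tx a : J a -> p <= t a < x.
  move=> Ja; have [/andP[py yx] _ _] := yP a Ja.
  by rewrite le_max py gt_max yx; case/andP: (Cpx _ (gJ a Ja)).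
have /choice[Kc KcP] := exists_cut_family (R := R) K_compact K_one_sided.
have /choice[G GP] a : exists F, J a -> sigma_family F /\
    forall u v, p <= u <= t a -> p <= v <= t a -> u != v ->
      exists2 f, F f & f u != f v.
  have [Ja|nJa] := pselect (J a); last by exists set0.
  by have [F sF sepF] := gpx _ (tx a Ja); exists F.
pose e z : R := if z \in [set z | z <= x] then 1%R else 0%R.
have ce : continuous e.
  by apply: continuous_indicator => //; exact: closed_ray_le.
have e1 z : z <= x -> e z = 1%R by move=> zx; rewrite /e mem_set.
have e0 z : x < z -> e z = 0%R by move=> xz; rewrite /e memNset//= leNgt xz.
(* The cut at [t a] separates points on its two sides; the cut at [y a] supplies multipliers without
   common zero on (y a, x]. The factor [e] kills everything beyond [x]. *)
pose H a := [set (fun z => k z * e z)%R | k in Kc (y a) `|` Kc (t a)].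
have cH a : countable (H a).
  apply: sub_countable (card_image_le _ _) _.
  by apply: countableU; [case: (KcP (y a))|case: (KcP (t a))].
have ctH a h : H a h -> continuous h.
  move=> [k [] Kk <-]; apply: continuous_mul => //.
    by have [_ + _ _] := KcP (y a); apply.
  by have [_ + _ _] := KcP (t a); apply.
have H0 a z h : H a h -> z < y a \/ x < z -> h z = 0%R.
  move=> [k Kk <-] [zy|/e0 ->]; last by rewrite mulr0.
  suff -> : k z = 0%R by rewrite mul0r.
  case: Kk => Kk.
    by have [_ _ + _] := KcP (y a); apply.
  by have [_ _ + _] := KcP (t a); apply => //; rewrite lt_max zy.
have Ht a u v : u < t a -> t a < v -> v <= x -> exists2 h, H a h & h u != h v.
  move=> ut tv vx; have [_ _ Kc0 /(_ v tv)[k Kk kv]] := KcP (t a).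
  exists (fun z => k z * e z)%R; first by exists k => //; right.
  by rewrite (Kc0 _ _ Kk ut) mul0r e1// mulr1 eq_sym.
(* [H a] alone separates points on which its members differ; where they agree,
   they do not all vanish, so multiplying by them loses nothing of [G a]. *)
pose FJ a := H a `|` \bigcup_(h in H a) [set (fun z => f z * h z)%R | f in G a].
apply: (@ltW_sigma_separated _ _ _ _ (\bigcup_(a in J) FJ a)).
  apply: bigcup_sigma_family => [a Ja|z cz].
    apply: setU_sigma_family.
      exact: countable_sigma_family (ctH a) (cH a).
    exact: mul_sigma_family (proj1 (GP a Ja)) (cH a) (ctH a).
  have FJ0 a : (exists2 f, FJ a f & (f z != 0)%R) -> y a <= z <= x.
    move=> [f Ff fz]; rewrite !leNgt -negb_or; apply: contra fz => zz.
    have {}H0 h : H a h -> h z = 0%R by move=> /H0; apply; apply/orP.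
    case: Ff => [/H0 ->//|[h /H0 hz [k _ <-]]].
    by rewrite hz mulr0.
  (* Beyond [x] all functions vanish, and z = x is excluded since z has countable character. *)
  have [zx|xz] := ltP z x; last first.
    apply: (sub_countable _ (@countable0 K)).
    apply: subset_card_le => a [_ /FJ0/andP[_ zx]].
    by apply: ucx; rewrite (@le_anti _ _ x z) ?xz.
  have [a' Ja' za'] := Jg z zx.
  apply: (sub_countable _ (countableU (countable1 a') (Jseg a' Ja'))).
  apply: subset_card_le => a [Ja /FJ0/andP[yz _]].
  (* An index [a] after [a'] would have z < [g a'] <= [y a], so its functions vanish at z. *)
  have /or3P[aa'|a'a|/eqP ->] := tri a a'; [by right|exfalso|by left].
  have [_ ya _] := yP a Ja.
  by move: (lt_le_trans za' (le_trans (ya a' Ja' a'a) yz)); rewrite ltxx.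
(* No piece contains [x], so v = x is treated apart: a cut at some [t a] between u and [x] separates
   them. *)
move=> u v /= /andP[pu ux] /andP[pv]; rewrite le_eqVlt => /orP[/eqP ->|vx] uv.
  have [a Ja ua] := Jg u uv.
  have [||h Hh huv] := Ht a u x _ _ (lexx x).
  - by rewrite lt_max ua orbT.
  - by case/andP: (tx a Ja).
  by exists h => //; exists a => //; left.
have [|a [Ja vta] amin] := minP [set a | J a /\ v <= t a].
  have [a Ja va] := Jg v vx; exists a; split=> //.
  by rewrite le_max (ltW va) orbT.
have tlt b : J b -> prec b a -> t b < v.
  by move=> Jb ba; rewrite ltNge; apply/negP => vtb; exact: (amin b ba).
(* If u < [y a], some earlier [b] has u < [g b] <= [t b] < v, and the cut at [t b] separates u from
   v. *)
have [yau|uya] := leP (y a) u; last first.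
  have [b [Jb ba ub]] : exists b, [/\ J b, prec b a & u < g b].
    apply: contrapT => nb; have [_ _ /(_ u pu)] := yP a Ja.
    suff /[swap]/[apply] : below a u by rewrite leNgt uya.
    by move=> b Jb ba; rewrite leNgt; apply/negP => ub; apply: nb; exists b.
  have [||h Hh huv] := Ht b u v _ _ (ltW vx).
  - by rewrite lt_max ub orbT.
  - exact: tlt.
  by exists h => //; exists b => //; left.
have [[h Hh huv]|nH] := pselect (exists2 h, H a h & h u != h v).
  by exists h => //; exists a => //; left.
have [||f Gf fuv] := (GP a Ja).2 u v _ _ (negbT (lt_eqF uv)).
- by rewrite pu (le_trans (ltW uv)).
- by rewrite pv.
have [_ _ _ /(_ v (le_lt_trans yau uv))[k Kk kv]] := KcP (y a).
pose h z := (k z * e z)%R.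
have Hh : H a h by exists k => //; left.
have huv : h u = h v.
  by apply/eqP; apply: contra_notT nH => huv; exists h.
exists (fun z => f z * h z)%R.
  by exists a => //; right; exists h => //; exists f.
rewrite huv; apply: contra_neq fuv; apply: mulIf.
by rewrite /h e1 ?(ltW vx)// mulr1.
Qed.

Lemma sigma_separated_limit p x : p <= x ->
  (forall y, p <= y < x -> good [set z | p <= z <= y]) ->
  good [set z | p <= z <= x].
Proof.
rewrite le_eqVlt => /orP[/eqP <- _|px gpx].
  exists set0; first exact: countable_sigma_family.
  by move=> u v /= /le_anti <- /le_anti <-; rewrite eqxx.
(* If [x] has an immediate predecessor, a jump is glued on; otherwise the two kinds of cofinality
   are treated separately. *)
have [dx|] := pselect (forall y, y < x -> exists z, y < z < x); last first.
  move=> /existsNP[y /not_implyP[yx /forallNP nz]].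
  have [yp|py] := ltP y p.
    by case: (nz p); rewrite yp px.
  apply: (@sigma_separated_glue _ _ _ K_compact K_one_sided _ y).
    by apply: gpx; rewrite py.
  exact: sigma_separated_jump.
have [[C cC Ccof]|nC] := pselect (exists2 C, countable C & cofinal_in p x C).
  exact: sigma_separated_countable_limit Ccof gpx.
exact: sigma_separated_uncountable_limit.
Qed.

End limit.

(** * Largest good intervals with a given left end *)

Section interval_ends.
Context {R : realType} {d : Order.disp_t} {K : orderTopologicalType d}.
Implicit Types (p q : K).
Local Open Scope order_scope.

Hypothesis K_compact : compact [set: K].
Hypothesis K_one_sided : one_sided (K := K).
Hypothesis K_weight : weight_le_aleph1 K.

Local Notation good := (@sigma_separated R K).

(** The supremum of the good right ends is again good, by [sigma_separated_limit]. *)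
Lemma max_sigma_separated p : exists2 b, p <= b /\ good [set z | p <= z <= b] &
  forall w, p <= w -> good [set z | p <= z <= w] -> w <= b.
Proof.
have limit x := @sigma_separated_limit R d K K_compact K_one_sided K_weight p x.
have gpp : good [set z | p <= z <= p].
  by apply: limit => // y /andP[/le_lt_trans/[apply]]; rewrite ltxx.
have [b [bub bleast]] :=
  @exists_sup _ K [set w | p <= w /\ good [set z | p <= z <= w]] K_compact
    (ex_intro _ p (conj (lexx p) gpp)).
have pb : p <= b by exact: bub.
exists b; last by move=> w pw gw; exact: bub.
split=> //; apply: limit => // y /andP[py yb].
apply: contrapT => ng; suff : b <= y by rewrite leNgt yb.
apply: bleast => w [pw gw]; rewrite leNgt; apply/negP => yw; apply: ng.
apply: sigma_separatedS gw => z /= /andP[-> zy] /=.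
exact: le_trans zy (ltW yw).
Qed.

End interval_ends.

(** * Scatteredness leaves a single class *)

Section scattered_line.
Context {R : realType} {d : Order.disp_t} {K : orderTopologicalType d}.
Implicit Types (p q : K).
Local Open Scope order_scope.

Hypothesis K_compact : compact [set: K].
Hypothesis K_one_sided : one_sided (K := K).
Hypothesis K_weight : weight_le_aleph1 K.

Local Notation good := (@sigma_separated R K).

(** This is [max_sigma_separated] for the reversed order; a good [u, a] with u < a could be glued to
    [a, q], against minimality. *)
Lemma min_sigma_separated q : exists2 a, a <= q /\ good [set z | a <= z <= q] &
  forall u, u < a -> ~ good [set z | u <= z <= a].
Proof.
have dual_sided : one_sided (K := dual_line K).
  by move=> x /K_one_sided[]; [right|left].
have [a [aq ga] amin] :=
  @max_sigma_separated R _ (dual_line K) K_compact dual_sided K_weight q.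
have dualE (u v : K) :
    [set z : K | u <= z <= v] =
    [set z : dual_line K | (v : dual_line K) <= z <= u].
  by apply/seteqP; split=> z /=; rewrite andbC.
have {}ga : good [set z : K | (a : K) <= z <= q] by rewrite dualE.
exists a => // u ua gua.
suff : (a : K) <= u by rewrite leNgt ua.
apply: amin; first exact: (le_trans (ltW ua) aq).
have : good [set z : K | u <= z <= q] by exact: sigma_separated_glue ga.
by rewrite dualE.
Qed.

Lemma scattered_sigma_separated (F : set K) :
  closed F -> scattered (set_type F) ->
  (forall u v, (forall z, u <= z <= v -> ~ F z) ->
    good [set z | u <= z <= v]) ->
  good setT.
Proof.
move=> clF scF free.
(* [A] is the set of left ends of the classes other than the first. *)
pose A a :=
  (exists u, u < a) /\ forall u, u < a -> ~ good [set z | u <= z <= a].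
have between u a : u < a -> ~ good [set z | u <= z <= a] ->
    exists w, u < w < a.
  move=> ua; apply: contra_notP => /forallNP nw; exact: sigma_separated_jump.
(* Otherwise a left neighborhood of [a] misses [F] and is good by [free]. *)
have AF a : A a -> F a.
  move=> [[p pa] nga]; apply: contrapT => nFa.
  have [u /andP[_ ua] uF] :=
    nbhs_left (open_nbhs_nbhs (conj (closed_openC clF) nFa)) pa.
  have [w /andP[uw wa]] := between u a ua (nga u ua).
  apply: (nga w wa); apply: free => z /andP[wz za].
  by apply: uF; rewrite za (lt_le_trans uw).
(* The class of [u] ends at some b < a. A point w between b and [a] lies in a later class, whose
   left end is the required [a']. *)
have Adense u a : A a -> u < a -> exists2 a', A a' & u < a' < a.
  move=> [_ nga] ua; have [b [ub gub] bmax] :=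
    @max_sigma_separated R _ K K_compact K_one_sided K_weight u.
  have ba : b < a.
    rewrite ltNge; apply/negP => ab; apply: (nga u ua).
    by apply: sigma_separatedS gub => z /= /andP[-> /le_trans ->].
  have [w /andP[bw wa]] := between b a ba (nga b ba).
  have [a' [aw ga'w] nga'] := min_sigma_separated w.
  have ba' : b < a'.
    rewrite ltNge; apply/negP => a'b.
    suff /bmax : good [set z | u <= z <= w].
      by move=> /(_ (le_trans ub (ltW bw))); rewrite leNgt bw.
    apply: (@sigma_separated_glue _ _ _ K_compact K_one_sided _ b) => //.
    apply: sigma_separatedS ga'w => z /= /andP[bz ->].
    by rewrite (le_trans a'b).
  exists a'; first by split=> //; exists b.
  by rewrite (le_lt_trans ub ba') (le_lt_trans aw wa).
have [[a0 Aa0]|nA] := pselect (exists a, A a).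
  have [|s [/set_mem As [V /nbhs_set_type[V' V's V'V] /seteqP[VA _]]]] :=
    scF [set s : set_type F | A (set_val s)].
    by exists (SigSub (mem_set (AF a0 Aa0))).
  have [[p pa] _] := As.
  have [u /andP[_ ua] uV'] := nbhs_left V's pa.
  have [a' Aa' /andP[ua' a'a]] := Adense u _ As ua.
  have sa' : SigSub (mem_set (AF a' Aa')) = s.
    by apply: VA; split=> //; apply: V'V; apply: uV'; rewrite /= ua' ltW.
  by move: a'a; rewrite -sa' ltxx.
have [[x0 _]|nK] := pselect ([set: K] !=set0); last first.
  by exists set0 => [|x]; [exact: countable_sigma_family|case: nK; exists x].
(* With [A] empty, nothing can lie to the left of the class of the greatest point [M]. *)
have [M [Mub _]] := @exists_sup _ K [set: K] K_compact (ex_intro _ x0 I).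
have [a [_ gaM] nga] := min_sigma_separated M.
apply: sigma_separatedS gaM => z _ /=; rewrite Mub// andbT leNgt.
by apply/negP => za; apply: nA; exists a; split=> //; exists z.
Qed.

End scattered_line.

(** * From a separating family to a Valdivia embedding *)

Section valdivia.
Context {R : realType} {T : topologicalType}.

Lemma scattered_dense_countable_character (U : set T) :
  scattered (set_type (closure (uncountable_character T))) ->
  open U -> U !=set0 -> exists2 z, U z & countable_character z.
Proof.
set F := closure _ => scF oU [z0 Uz0]; apply: contrapT => nU.
have UF : U `<=` F.
  by move=> z Uz; apply: subset_closure => cz; apply: nU; exists z.
have [|s [/set_mem Us [V /nbhs_set_type[V' V's V'V] /seteqP[VU _]]]] :=
    scF [set s : set_type F | U (set_val s)].
  by exists (SigSub (mem_set (UF z0 Uz0))).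
(* The point is isolated in the open set [U], so its singleton alone is a neighborhood base. *)
apply: nU; exists (set_val s) => //; exists [set [set set_val s]].
  exact: countable1.
have nbs : nbhs (set_val s) [set set_val s].
  have : nbhs (set_val s) (V' `&` U).
    by apply: filterI => //; exact: open_nbhs_nbhs.
  apply: filterS => z [V'z Uz].
  have <- // : SigSub (mem_set (UF z Uz)) = s.
  by apply: VU; split=> //; exact: V'V.
split=> [_ -> //|W /nbhs_singleton Ws].
by exists [set set_val s] => // z ->.
Qed.

Lemma sigma_separated_valdivia : hausdorff_space T -> compact [set: T] ->
  (forall U : set T, open U -> U !=set0 ->
    exists2 z, U z & countable_character z) ->
  sigma_separated (R := R) [set: T] -> valdivia_compact R T.
Proof.
move=> hT cT ccd [F [cF F0] sepF]; split=> //.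
(* Coordinates are indexed by all functions; those outside [F] are set to 0 and add nothing to
   supports. *)
pose phi (x : T) : {ptws (T -> R) -> R} := fun f => if f \in F then f x else 0.
have cphi : continuous phi.
  move=> x; apply/cvg_sup => f U.
  rewrite nbhsE => -[_ [[W oW <-] Wx]] /filterS; apply.
  have cf : continuous (fun y => phi y f).
    rewrite /phi; have [/set_mem/cF //|_ y] := boolP (f \in F).
    exact: cvg_cst.
  by apply: (cf x W); exact: open_nbhs_nbhs.
have phiI : injective phi.
  move=> x y xy; apply: contrapT => /eqP /(sepF x y I I)[f Ff] /eqP; apply.
  by have := congr1 (fun g => g f) xy; rewrite /phi mem_set.
exists (T -> R), (range phi).
pose h x : set_type (range phi) := SigSub (mem_set (imageT phi x)).
have ch : continuous h.
  apply/continuousP => _ [W oW <-].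
  by have := (continuousP _).1 cphi W oW.
split.
  exists h; split=> //.
  have /choice[g gP] (y : set_type (range phi)) : exists x, phi x = set_val y.
    by have [x _ xy] := set_valP y; exists x.
  have hK : cancel h g by move=> x; apply: phiI; rewrite gP.
  have gK : cancel g h by move=> y; apply: val_inj; rewrite /= gP.
  (* Closed sets are compact, so their images under [phi] are closed and the inverse is
     continuous. *)
  exists g; split=> //; apply/continuous_closedP => C cC.
  have -> : g @^-1` C = set_val @^-1` (phi @` C).
    apply/seteqP; split=> y /=; first by move=> Cgy; exists (g y).
    by move=> [x Cx xy]; have -> : g y = x by apply: phiI; rewrite gP.
  apply: closed_comp; first by move=> y _; exact: initial_continuous.
  apply: compact_closed.
    by apply: hausdorff_product => _; exact: Rhausdorff.
  apply: continuous_compact; first exact: continuous_subspaceT.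
  exact: subclosed_compact cC cT _.
move=> O [y Oy] oO.
have [|z Oz cz] := ccd (h @^-1` O) (open_comp (fun _ _ => ch _) oO).
  have [x _ xy] := set_valP y; exists x => /=.
  by have -> : h x = y by exact: val_inj.
exists (h z); split=> //=.
apply: sub_countable (F0 z cz); apply: subset_card_le => f hz.
have {hz} : phi z f != 0 by exact: hz.
by rewrite /phi; have [/set_mem//|_] := boolP (f \in F); rewrite eqxx.
Qed.

End valdivia.

Theorem theorem5p1 (R : realType) (d : Order.disp_t)
    (K : orderTopologicalType d)
    (K_compact : compact [set: K])
    (K_weight : weight_le_aleph1 K)
    (K_one_sided : forall x : K, uncountable_character K x ->
      open [set` `]-oo, x]%O] \/ open [set` `[x, +oo[%O])
    (K_metrizable : forall F : set K, closed F ->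
      first_countable (set_type F) -> metrizable R (set_type F))
    (K_scattered : scattered (set_type (closure (uncountable_character K)))) :
  valdivia_compact R K.
Proof.
apply: sigma_separated_valdivia => //; first exact: order_hausdorff.
  by move=> U; exact: scattered_dense_countable_character.
apply: (scattered_sigma_separated K_compact _ K_weight _ K_scattered).
- by move=> x /K_one_sided; rewrite set_itvNyc set_itvcy.
- exact: closed_closure.
(* The interval [u, v] contains no point of uncountable character, so it is first countable,
   metrizable by (iii) and, being compact, second countable. *)
move=> u v uvF.
have cl : closed [set z | (u <= z <= v)%O].
  by rewrite -set_itvcc; exact: itv_closed.
apply: (second_countable_sigma_separated _ order_hausdorff K_compact).
apply: (compact_metrizable_second_countable (R := R)).
  apply: K_metrizable => // s; apply: countable_character_set_type.
  apply: contrapT => ucs; apply: (uvF _ (set_valP s)).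
  exact: (@subset_closure K (uncountable_character K)).
by apply: compact_set_type; exact: subclosed_compact cl K_compact _.
Qed.
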